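(* Let $l$ be a fixed positive integer (a constant independent of $n$). For each $n \ge 1$ consider the coupon collecting process with $n$ coupon types, and for integers $t\ge 0$ and $i\ge 0$ let $Y_t^i = Y_t^i(n)$ be the number of coupon types of which exactly $i$ copies have been collected after $t$ steps. Let $z_0, z_1, \dots, z_l : [0,\infty) \to \mathbb{R}$ be the solution of the system of differential equations $$\frac{dz_i}{ds} = f_i(s, z_0, z_1, \dots, z_l), \qquad f_i(s,z_0,\dots,z_l) = z_{i-1} - z_i, \qquad 0 \le i \le l,$$ where $z_{-1} := 0$, with initial conditions $z_0(0) = 1$ and $z_i(0) = 0$ for $0 < i \le l$. Then almost surely $$Y_t^i = n\, z_i(t/n) + o(n)$$ uniformly for $0 \le t \le n \ln n$ and for each $0 < i < l$. That is, there is a function $\omega(n)$ with $\omega(n)/n \to 0$ as $n\to\infty$ such that $$\mathbb{P}\Big( \big| Y_t^i - n\, z_i(t/n) \big| \le \omega(n) \text{ for all integers } 0 \le t \le n\ln n \text{ and all integers } 0 < i < l \Big) \to 1 \quad \text{as } n \to \infty .$$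
   Context: Coupon collecting process: there are $n$ different coupon types, labelled $1,\dots,n$. At each step $t = 1,2,3,\dots$ one coupon is obtained, its type being drawn uniformly at random from $\{1,\dots,n\}$, independently of all previous draws (drawing with replacement); the collector keeps every coupon obtained. At time $t=0$ no coupon has been collected, so $Y_0^0 = n$ and $Y_0^i = 0$ for $i > 0$. Convention: for a sequence of random processes indexed by $n$, an event is said to occur ''almost surely'' if its probability in the $n$-th process is $1 - o(1)$ as $n \to \infty$. *)

(* Defs.v *)
From HB Require Import structures.
From mathcomp Require Import all_boot all_order all_algebra.
From mathcomp Require Import all_classical all_reals all_analysis.

Set Implicit Arguments.
Unset Strict Implicit.
Unset Printing Implicit Defensive.

Import Order.TTheory GRing.Theory Num.Theory.
Import numFieldNormedType.Exports.

Local Open Scope classical_set_scope.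
Local Open Scope ring_scope.

(* Mutual independence of the random variables [X j], [j] in [D]: the product
   rule holds for every finite subfamily. *)
Definition mutually_independent (R : realType) (d d' : measure_display)
    (T : measurableType d) (E : measurableType d') (P : probability T R)
    (I : choiceType) (D : set I) (X : I -> {RV P >-> E}) : Prop :=
  forall (J : seq I) (B : I -> set E),
    uniq J -> [set` J] `<=` D -> (forall j, measurable (B j)) ->
    P (\bigcap_(j in [set` J]) X j @^-1` B j)
      = (\prod_(j <- J) P (X j @^-1` B j))%E.

(* [X t] is the type of the coupon obtained at step [t = 1, 2, ...]; [X 0] is
   a dummy that nothing constrains or uses. *)
Definition coupon_collecting (R : realType) (d : measure_display)
    (T : measurableType d) (P : probability T R) (n : nat)
    (X : nat -> {RV P >-> nat}) : Prop :=
  [/\ forall t w, (0 < t)%N -> (1 <= X t w <= n)%N,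
      forall t c, (0 < t)%N -> (1 <= c <= n)%N ->
        P (X t @^-1` [set c]) = (n%:R^-1)%:E
    & mutually_independent [set t | (0 < t)%N] X].

Definition copies (T : Type) (X : nat -> T -> nat) (t c : nat) (w : T) : nat :=
  count (fun s => X s w == c) (index_iota 1 t.+1).

(* [num_types n X t i w] is Y_t^i(n) at the outcome [w]. *)
Definition num_types (T : Type) (n : nat) (X : nat -> T -> nat) (t i : nat)
    (w : T) : nat :=
  count (fun c => copies X t c w == i) (index_iota 1 n.+1).

(* The derivative at [s] of a function on [0, oo); one-sided at [s = 0]. Only
   the values of [f] on [0, oo) matter. *)
Definition has_derivative_ge0 (R : realType) (f : R -> R) (s a : R) : Prop :=
  (f u - f s) / (u - s) @[u --> within `[0, +oo[ s^'] --> a.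

(* The right-hand side f_i(s, x_0, x_1, ...), with the convention x_{-1} = 0. *)
Definition coupon_rhs (R : realType) (i : nat) (s : R) (x : nat -> R) : R :=
  (if i is j.+1 then x j else 0) - x i.

(* Only z_0, ..., z_l, on [0, oo), are constrained. *)
Definition coupon_ode_solution (R : realType) (l : nat) (z : nat -> R -> R)
    : Prop :=
  [/\ forall i s, (i <= l)%N -> 0 <= s ->
        has_derivative_ge0 (z i) s (coupon_rhs i s (z ^~ s)),
      z 0%N 0 = 1
    & forall i, (0 < i <= l)%N -> z i 0 = 0].

(* Main.v *)
Require Import Defs.
From HB Require Import structures.
From mathcomp Require Import all_boot all_order all_algebra.
From mathcomp Require Import all_classical all_reals all_analysis.
From mathcomp Require Import ring lra.

Set Implicit Arguments.
Unset Strict Implicit.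
Unset Printing Implicit Defensive.

Import Order.TTheory GRing.Theory Num.Theory.
Import numFieldNormedType.Exports.

Local Open Scope classical_set_scope.
Local Open Scope ring_scope.

(* Let W_i(t) = Y_t^i - n z_i(t/n).  The conditional mean of Y_{t+1}^i - Y_t^i is
   (Y_t^{i-1} - Y_t^i)/n, and the ODE is linear with the same right-hand side, so
   2 x y <= x^2 + y^2 gives the one-step recursion
     E W_i(t+1)^2 <= (1 - 1/n) E W_i(t)^2 + (1/n) E W_{i-1}(t)^2 + 25,
   whence E W_i(t)^2 <= 25 (i+1) n for every t.  Since W_i moves by at most 3 per
   step, Chebyshev's inequality on a grid of times of mesh about n^(7/8) and a union
   bound control all t <= n ln n at once.  Expectations are averages over the
   words of length t in the letters 1, ..., n. *)

(** * The differential equations *)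

(** Near a positive point the constraint [0 <= u] holds automatically, so the derivative on
    [[0, oo)] is the ordinary two-sided one and the mean value theorem becomes available. *)
Lemma has_derivative_ge0_is_derive (R : realType) (f : R -> R) (s a : R) :
  0 < s -> has_derivative_ge0 f s a -> is_derive s 1 f a.
Proof.
move=> s_gt0 df.
have dfh : h^-1 *: ((f \o shift s) (h *: (1 : R)) - f s) @[h --> 0^'] --> a.
  have shift_cvg : h + s @[h --> 0^'] --> within `[0, +oo[ s^'.
    move=> P hP; have {}hP : \forall u \near s, u != s -> 0 <= u -> P u.
      have {}hP : \forall u \near s, u != s -> u \in `[0, +oo[ -> P u by exact: hP.
      apply: filterS hP => u hu us u0; apply: hu => //=.
      by rewrite in_itv /= u0.
    have : \forall u \near s, u != s -> P u.
      apply: filterS2 hP (lt_nbhsr s_gt0) => u hu u0 us.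
      exact: hu us (ltW u0).
    rewrite (near_shift 0 s) subr0 => {}hP.
    suff : \forall h \near (0 : R), h != 0 -> P (h + s) by exact.
    by apply: filterS hP => h /= hP' h0; apply: hP'; rewrite -subr_eq0 addrK.
  have := cvg_comp _ _ shift_cvg df.
  apply: cvg_trans; apply: near_eq_cvg; near=> h.
  by rewrite /= addrK mulrC scaler1.
have dv : 'D_1 f s = a by apply: cvg_lim.
by apply: DeriveDef => //; apply/cvg_ex; exists a.
Unshelve. all: by end_near.
Qed.

(** Writes [f u] as the difference quotient times [u - s], plus [f s]. This supplies continuity at
    the endpoint 0, where only right limits make sense. *)
Lemma has_derivative_ge0_cvg_at_right (R : realType) (f : R -> R) (s a : R) :
  0 <= s -> has_derivative_ge0 f s a -> f u @[u --> s^'+] --> f s.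
Proof.
move=> s_ge0 df.
have right_sub : s^'+ --> within `[0, +oo[ s^'.
  move=> P hP.
  have {}hP : \forall u \near s, u != s -> u \in `[0, +oo[ -> P u by exact: hP.
  suff : \forall u \near s, s < u -> P u by exact.
  apply: filterS hP => u hu su; apply: hu; first by rewrite gt_eqF.
  by rewrite /= in_itv /= andbT (le_trans s_ge0 (ltW su)).
have {right_sub}df : (f u - f s) / (u - s) @[u --> s^'+] --> a.
  by apply: cvg_trans df; exact: cvg_app.
have id_s : (u - s) @[u --> s^'+] --> (0 : R).
  rewrite -(subrr s); apply: cvgB; last exact: cvg_cst.
  by apply: cvg_at_right_filter; exact: cvg_id.
have : (f u - f s) / (u - s) * (u - s) + f s @[u --> s^'+] --> f s.
  rewrite -[X in _ --> X]add0r -(mulr0 a).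
  by apply: cvgD; [exact: cvgM | exact: cvg_cst].
apply: cvg_trans; apply: near_eq_cvg.
near=> u; rewrite /= divfK ?subrK // subr_eq0 gt_eqF //.
Unshelve. all: by end_near.
Qed.

Lemma has_derivative_ge0_continuous (R : realType) (f df : R -> R) (a b : R) :
  0 <= a -> a < b ->
  (forall s, 0 <= s -> has_derivative_ge0 f s (df s)) ->
  {within `[a, b], continuous f}.
Proof.
move=> a_ge0 ab hf.
have cf x : 0 < x -> {for x, continuous f}.
  move=> x_gt0; apply: differentiable_continuous; apply/derivable1_diffP.
  by have [] := has_derivative_ge0_is_derive x_gt0 (hf x (ltW x_gt0)).
apply/continuous_within_itvP => //; split.
- by move=> x; rewrite in_itv /= => /andP[ax _]; apply/cf/(le_lt_trans a_ge0).
- exact: has_derivative_ge0_cvg_at_right (hf a a_ge0).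
- by apply: cvg_at_left_filter; apply/cf/(le_lt_trans a_ge0).
Qed.

Lemma has_derivative_ge0_MVT (R : realType) (f df : R -> R) (a b : R) :
  0 <= a -> a < b ->
  (forall s, 0 <= s -> has_derivative_ge0 f s (df s)) ->
  exists2 c, a < c < b & f b - f a = df c * (b - a).
Proof.
move=> a_ge0 ab hf.
have [||c] := @MVT R f df a b ab.
- move=> x; rewrite in_itv /= => /andP[ax _].
  have x_gt0 := le_lt_trans a_ge0 ax.
  exact: has_derivative_ge0_is_derive (hf x (ltW x_gt0)).
- exact: has_derivative_ge0_continuous hf.
by rewrite in_itv /= => cab ->; exists c.
Qed.

Lemma has_derivative_ge0N (R : realType) (f : R -> R) (s a : R) :
  has_derivative_ge0 f s a -> has_derivative_ge0 (\- f) s (- a).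
Proof.
move=> /cvgN; rewrite /has_derivative_ge0; apply: cvg_trans.
by apply: near_eq_cvg; apply: nearW => u; rewrite /= -mulNr opprD.
Qed.

(* [f' = g - f <= 1 - f] makes [expR s * (f s - 1)] nonincreasing. *)
Lemma relaxation_le1 (R : realType) (f g : R -> R) (s : R) :
  (forall u, 0 <= u -> has_derivative_ge0 f u (g u - f u)) ->
  (forall u, 0 <= u -> g u <= 1) -> f 0 <= 1 -> 0 <= s -> f s <= 1.
Proof.
move=> df g_le1 f0; rewrite le_eqVlt => /predU1P[<- //|s_gt0].
pose h u : R := expR u * (f u - 1).
have [||c] := @MVT R h (fun u => expR u * (g u - 1)) 0 s s_gt0.
- move=> u; rewrite in_itv /= => /andP[u_gt0 _].
  have fu := has_derivative_ge0_is_derive u_gt0 (df u (ltW u_gt0)).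
  by apply: is_derive_eq; rewrite /GRing.scale /=; ring.
- have fc := has_derivative_ge0_continuous (lexx 0) s_gt0 df.
  have ec : {within `[0, s], continuous (@expR R)}.
    exact: continuous_subspaceT (@continuous_expR R).
  move=> x; apply: cvgM; first exact: ec.
  by apply: cvgB; [exact: fc | exact: cvg_cst].
rewrite in_itv /= => /andP[c_gt0 _]; rewrite subr0 => hs.
have hs_le : h s - h 0 <= 0.
  rewrite hs pmulr_lle0 // pmulr_rle0 ?expR_gt0 // subr_le0.
  exact: g_le1 (ltW c_gt0).
have h0_le : h 0 <= 0 by rewrite /h expR0 mul1r subr_le0.
have : h s <= 0 by lra.
by rewrite /h pmulr_rle0 ?expR_gt0 // subr_le0.
Qed.

(* The convention [x_{-1} = 0]. *)
Definition prev (V : zmodType) (x : nat -> V) (i : nat) : V :=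
  if i is j.+1 then x j else 0.

(** * A priori bounds on the solution *)

Section OdeSolution.
Variables (R : realType) (l : nat) (z : nat -> R -> R).
Hypothesis z_sol : coupon_ode_solution l z.

Let z_derive i s : (i <= l)%N -> 0 <= s ->
  has_derivative_ge0 (z i) s (prev (z^~ s) i - z i s).
Proof. by case: z_sol => dz _ _ il s0; exact: dz. Qed.

Let z_init i : (i <= l)%N -> z i 0 = (i == 0%N)%:R.
Proof. by case: z_sol => _ z00 z0; case: i => // i il; rewrite z0. Qed.

(** Induction on [i]: [relaxation_le1] is applied both to [z i] and to its negative. The role of [g]
    is played by plus or minus the preceding function, which is 0 when [i] is 0. *)
Lemma ode_solution_norm_le1 i s : (i <= l)%N -> 0 <= s -> `|z i s| <= 1.
Proof.
elim: i s => [|i IH] s il s0; rewrite ler_norml.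
all: have z0 := z_init il; rewrite /= in z0.
all: have zd u := z_derive (s := u) il; rewrite /= in zd.
- apply/andP; split; last first.
    by apply: (relaxation_le1 zd) => //; rewrite ?z0.
  rewrite lerNl; apply: (relaxation_le1 (f := \- z 0%N) (g := fun=> 0)) => //.
    move=> u u0; rewrite [0 - _](_ : _ = - (0 - z 0%N u)); last by rewrite /=; ring.
    exact: has_derivative_ge0N (zd u u0).
  by rewrite /= z0 (le_trans _ ler01) // oppr_le0.
- have {}IH u : 0 <= u -> -1 <= z i u <= 1.
    by move=> u0; rewrite -ler_norml IH // ltnW.
  apply/andP; split; last first.
    apply: (relaxation_le1 zd) => //; last by rewrite z0.
    by move=> u /IH/andP[].
  rewrite lerNl; apply: (relaxation_le1 (f := \- z i.+1) (g := \- z i)) => //.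
  + move=> u u0; rewrite [_ - _](_ : _ = - (z i u - z i.+1 u)); last by rewrite /=; ring.
    exact: has_derivative_ge0N (zd u u0).
  + by move=> u /IH/andP[]; rewrite lerNl.
  + by rewrite /= z0 oppr0.
Qed.

Lemma ode_solution_prev_norm_le1 i s :
  (i <= l)%N -> 0 <= s -> `|prev (z^~ s) i| <= 1.
Proof.
case: i => [|i] il s0 /=; first by rewrite normr0.
exact: ode_solution_norm_le1 (ltnW il) s0.
Qed.

Lemma ode_solution_lipschitz i s u : (i <= l)%N -> 0 <= s -> s <= u ->
  `|z i u - z i s| <= 2 * (u - s).
Proof.
move=> il s0; rewrite le_eqVlt => /predU1P[<-|su].
  by rewrite !subrr normr0 mulr0.
have [c /andP[sc _] ->] := has_derivative_ge0_MVT s0 su (fun u => z_derive il).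
have c0 : 0 <= c := le_trans s0 (ltW sc).
have su_ge0 : 0 <= u - s by rewrite subr_ge0 ltW.
rewrite normrM (ger0_norm su_ge0) ler_wpM2r //.
apply: le_trans (ler_normB _ _) _.
by rewrite (natrD _ 1 1) lerD ?ode_solution_norm_le1 ?ode_solution_prev_norm_le1.
Qed.

Lemma ode_solution_prev_lipschitz i s u : (i <= l)%N -> 0 <= s -> s <= u ->
  `|prev (z^~ u) i - prev (z^~ s) i| <= 2 * (u - s).
Proof.
case: i => [|i] il s0 su /=; last exact: ode_solution_lipschitz (ltnW il) s0 su.
by rewrite subrr normr0 mulr_ge0 // subr_ge0.
Qed.

(** Stands in for a second-derivative bound. The increment is [u - s] times the derivative at some
    [c] between [s] and [u]; both terms of that derivative are 2-Lipschitz, hence the constant 4. *)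
Lemma ode_solution_euler i s u : (i <= l)%N -> 0 <= s -> s <= u ->
  `|z i u - z i s - (u - s) * (prev (z^~ s) i - z i s)| <= 4 * (u - s) ^+ 2.
Proof.
move=> il s0; rewrite le_eqVlt => /predU1P[<-|su].
  by rewrite !subrr mul0r subr0 normr0 expr0n mulr0.
have [c /andP[sc cu] ->] := has_derivative_ge0_MVT s0 su (fun u => z_derive il).
have su_ge0 : 0 <= u - s by rewrite subr_ge0 ltW.
set A := prev _ i; set B := prev _ i.
have -> : (A - z i c) * (u - s) - (u - s) * (B - z i s)
  = (u - s) * ((A - B) - (z i c - z i s)) by ring.
rewrite normrM ger0_norm // expr2 mulrCA ler_wpM2l //.
apply: le_trans (ler_normB _ _) _.
apply: (@le_trans _ _ (2 * (c - s) + 2 * (c - s))); last by lra.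
by rewrite lerD ?ode_solution_lipschitz ?ode_solution_prev_lipschitz // ltW.
Qed.

End OdeSolution.

(** * Mean square deviation over words *)

Definition words (n t : nat) : seq (seq nat) :=
  iter t (fun ws => [seq a :: s | a <- iota 1 n, s <- ws]) [:: [::]].

(** Conditioning on the first [t] draws: the inner sum averages, up to the factor [n], over the
    latest one. *)
Lemma big_words_cons (R : realType) (n t : nat) (F : seq nat -> R) :
  \sum_(s <- words n t.+1) F s =
  \sum_(s <- words n t) \sum_(a <- iota 1 n) F (a :: s).
Proof. by rewrite /= big_allpairs_dep exchange_big. Qed.

Lemma size_words (n t : nat) : size (words n t) = (n ^ t)%N.
Proof. by elim: t => //= t IH; rewrite size_allpairs size_iota IH expnS. Qed.

Lemma mem_words_cons (n t a : nat) (s : seq nat) :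
  (1 <= a <= n)%N -> s \in words n t -> a :: s \in words n t.+1.
Proof.
by move=> an s_t; apply/allpairsP; exists (a, s); rewrite mem_iota add1n ltnS.
Qed.

(* [occ n i s] is Y_t^i(n) when the word [s] lists the [t] coupons drawn. *)
Definition occ (n i : nat) (s : seq nat) : nat :=
  count (fun c => count_mem c s == i) (iota 1 n).

Lemma occ_le (n i : nat) (s : seq nat) : (occ n i s <= n)%N.
Proof. by rewrite -[leqRHS](size_iota 1 n) count_size. Qed.

Lemma occ_sum (R : realType) (n i : nat) (s : seq nat) :
  (occ n i s)%:R = \sum_(c <- iota 1 n) (count_mem c s == i)%:R :> R.
Proof.
rewrite /occ -sum1_count big_mkcond natr_sum.
by apply: eq_bigr => c _; case: eqP.
Qed.

Lemma occ_cons (R : realType) (n i a : nat) (s : seq nat) : a \in iota 1 n ->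
  (occ n i (a :: s))%:R = (occ n i s)%:R
    + (((count_mem a s).+1 == i)%:R - (count_mem a s == i)%:R) :> R.
Proof.
move=> an; rewrite !occ_sum !(bigD1_seq a) ?iota_uniq //= eqxx.
rewrite (eq_bigr (fun c => (count_mem c s == i)%:R)); first by rewrite add1n; ring.
by move=> c /negPf ca; rewrite [a == c]eq_sym ca.
Qed.

(** This is [n] times the conditional mean of the one-step change of [Y^i], and it has the form of
    the right-hand side of the differential equation. *)
Lemma sum_occ_increments (R : realType) (n i : nat) (s : seq nat) :
  \sum_(a <- iota 1 n) (((count_mem a s).+1 == i)%:R - (count_mem a s == i)%:R)
  = prev (fun j => (occ n j s)%:R) i - (occ n i s)%:R :> R.
Proof.
rewrite sumrB -occ_sum; congr (_ - _).
by case: i => [|i] /=; [rewrite big1 | rewrite occ_sum].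
Qed.

Section Deviation.
Variables (R : realType) (l : nat) (z : nat -> R -> R).
Hypothesis z_sol : coupon_ode_solution l z.
Variable n : nat.
Hypothesis n_gt0 : (0 < n)%N.

Definition deviation (t i : nat) (s : seq nat) : R :=
  (occ n i s)%:R - n%:R * z i (t%:R / n%:R).

Let n0 : 0 < n%:R :> R. Proof. by rewrite ltr0n. Qed.
Let time_ge0 t : 0 <= t%:R / n%:R :> R. Proof. by rewrite divr_ge0. Qed.
Let timeS t : t.+1%:R / n%:R - t%:R / n%:R = n%:R^-1 :> R.
Proof. by rewrite -mulrBl -natrB ?subSnn ?mul1r. Qed.
Let time_le t : t%:R / n%:R <= t.+1%:R / n%:R :> R.
Proof. by rewrite -subr_ge0 timeS invr_ge0 ltW. Qed.

Lemma deviation_nil i : (i <= l)%N -> deviation 0 i [::] = 0.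
Proof.
move=> il; rewrite /deviation mul0r occ_sum /=.
case: z_sol => _ z00 z0; case: i il => [|i] il.
  by rewrite z00 big_const_seq iter_addr_0 count_predT size_iota mulr1 subrr.
by rewrite z0 // mulr0 subr0 big1.
Qed.

Lemma deviation_norm_le t i s : (i <= l)%N -> `|deviation t i s| <= 2 * n%:R.
Proof.
move=> il; apply: le_trans (ler_normB _ _) _.
rewrite mulrDl mul1r lerD //; first by rewrite normr_nat ler_nat occ_le.
by rewrite normrM normr_nat ler_piMr // (ode_solution_norm_le1 z_sol).
Qed.

Lemma deviation_cons t i a s : (i <= l)%N -> a \in iota 1 n ->
  deviation t.+1 i (a :: s) = deviation t i s
    + (((count_mem a s).+1 == i)%:R - (count_mem a s == i)%:R
       - n%:R * (z i (t.+1%:R / n%:R) - z i (t%:R / n%:R))).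
Proof. by move=> il an; rewrite /deviation occ_cons //; ring. Qed.

Let drift_le t i : (i <= l)%N ->
  `|n%:R * (z i (t.+1%:R / n%:R) - z i (t%:R / n%:R))| <= 2.
Proof.
move=> il; rewrite normrM normr_nat mulrC -ler_pdivlMr //.
have := ode_solution_lipschitz z_sol il (time_ge0 t) (time_le t).
by rewrite timeS.
Qed.

(** One draw changes [Y^i] by at most 1, and [n z_i] changes by at most 2 over a time step [1/n]. *)
Lemma deviation_increment_le t i a s : (i <= l)%N -> a \in iota 1 n ->
  `|deviation t.+1 i (a :: s) - deviation t i s| <= 3.
Proof.
move=> il an; rewrite deviation_cons // addrC addKr.
have := drift_le t il; rewrite !ler_norml.
by case: eqP => _; case: eqP => _ /=; lra.
Qed.

(** The one-step recursion conditioned on the word [s], multiplied by [n]. After expanding the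
    square, the linear term sums to [2 W (pW - W - r)], where [r] is the scaled Euler error. *)
Lemma deviation_sqr_step t i s : (i <= l)%N ->
  \sum_(a <- iota 1 n) deviation t.+1 i (a :: s) ^+ 2 <=
  (n%:R - 1) * deviation t i s ^+ 2
    + prev (fun j => deviation t j s) i ^+ 2 + 25 * n%:R.
Proof.
move=> il; set W := deviation t i s.
set e := n%:R * (z i (t.+1%:R / n%:R) - z i (t%:R / n%:R)).
pose D a : R := ((count_mem a s).+1 == i)%:R - (count_mem a s == i)%:R.
have e_le : `|e| <= 2 := drift_le t il.
have W_le : `|W| <= 2 * n%:R := deviation_norm_le t s il.
(* The 9 bounds the square of the increment, which is at most 3 in absolute value. *)
have step a : a \in iota 1 n ->
    deviation t.+1 i (a :: s) ^+ 2 <= W ^+ 2 + 2 * W * (D a - e) + 9.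
  move=> an; rewrite deviation_cons // -/(D a) -/W -/e.
  have : `|D a - e| <= 3.
    move: e_le; rewrite /D !ler_norml.
    by case: eqP => _; case: eqP => _ /=; lra.
  move=> De; have : (D a - e) ^+ 2 <= 3 ^+ 2.
    by rewrite -[leLHS]real_normK ?num_real // lerXn2r ?nnegrE.
  by rewrite sqrrD; lra.
rewrite big_seq_cond; apply: (@le_trans _ _
  (\sum_(a <- iota 1 n) (W ^+ 2 + 2 * W * (D a - e) + 9))).
  rewrite [leRHS]big_seq_cond; apply: ler_sum => a; rewrite andbT; exact: step.
have sum_const (x : R) : \sum_(a <- iota 1 n) x = n%:R * x.
  by rewrite big_const_seq iter_addr_0 count_predT size_iota mulr_natl.
rewrite !big_split /= !sum_const -mulr_sumr sumrB sum_occ_increments sum_const.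
set pY := prev _ i; set pW := prev _ i.
have pWE : pW = pY - n%:R * prev (z^~ (t%:R / n%:R)) i.
  by rewrite /pW /pY /prev; case: (i) => [|j]; rewrite ?mulr0 ?subr0.
(* [r] is [n^2] times the Euler error over a step of length [1/n], so the bound [4 / n^2] becomes
   4. *)
set r := n%:R * e - n%:R * (prev (z^~ (t%:R / n%:R)) i - z i (t%:R / n%:R)).
have r_le : `|r| <= 4.
  have := ode_solution_euler z_sol il (time_ge0 t) (time_le t).
  rewrite timeS -(ler_pM2l (x := n%:R ^+ 2)) ?exprn_gt0 //.
  rewrite -{1}(ger0_norm (exprn_ge0 2 (ler0n R n))) -normrM.
  rewrite mulrCA -exprMn divff ?gt_eqF // expr1n mulr1.
  congr (`|_| <= _); rewrite /r /e; field.
  by rewrite gt_eqF.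
have -> : pY - (occ n i s)%:R - n%:R * e = pW - W - r.
  by rewrite pWE /W /deviation /r; ring.
(* Doubled, this contributes [16 n]; with the [9 n] from the squared increments it makes [25 n]. The
   cross term [2 W pW] is then absorbed by [(W - pW)^2 >= 0]. *)
have Wr : - (W * r) <= 8 * n%:R.
  have := ler_pM (normr_ge0 _) (normr_ge0 _) W_le r_le.
  rewrite -normrM ler_norml; lra.
have := sqr_ge0 (W - pW); lra.
Qed.

(** The mean-square bound [25 (i+1) n] is a fixed point of the recursion, since
    [(n-1)(i+1) n + i n + n = n (i+1) n]; hence it does not grow with [t]. The factor [n^t] counts
    the words. *)
Lemma sum_deviation_sqr_le t i : (i <= l)%N ->
  \sum_(s <- words n t) deviation t i s ^+ 2 <= 25 * i.+1%:R * n%:R * n%:R ^+ t.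
Proof.
elim: t i => [|t IH] i il.
  by rewrite big_seq1 deviation_nil // expr0n /= !mulr_ge0.
rewrite big_words_cons.
apply: le_trans (ler_sum _ (fun s _ => deviation_sqr_step t s il)) _.
rewrite !big_split /= -mulr_sumr big_const_seq iter_addr_0 count_predT size_words.
rewrite -[X in _ + X <= _]mulr_natl natrX.
have IHi := IH i il.
(* The bound with [i] in place of [i.+1] also covers [i = 0], where the preceding deviation is 0. *)
have IHp : \sum_(s <- words n t) prev (fun j => deviation t j s) i ^+ 2
   <= 25 * i%:R * n%:R * n%:R ^+ t.
  case: i il {IHi} => [|i] il /=; last exact: IH (ltnW il).
  by rewrite big1 ?mulr0 ?mul0r // => s _; rewrite expr0n.
have n1 : 0 <= n%:R - 1 :> R by rewrite subr_ge0 ler1n.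
have := ler_wpM2l n1 IHi.
rewrite exprS -(natr1 i).
lra.
Qed.

End Deviation.

(** * Words drawn by the collector *)

(* The most recent draw comes first. *)
Fixpoint word (T : Type) (X : nat -> T -> nat) (t : nat) (w : T) : seq nat :=
  if t is u.+1 then X u.+1 w :: word X u w else [::].

Lemma num_types_word (T : Type) (X : nat -> T -> nat) (n t i : nat) (w : T) :
  num_types n X t i w = occ n i (word X t w).
Proof.
rewrite /num_types /occ /index_iota subn1 /=; apply: eq_count => c.
rewrite /copies /index_iota subn1 /=; congr (_ == i).
elim: t => // t IH; rewrite (_ : iota 1 t.+1 = iota 1 t ++ [:: t.+1]).
  by rewrite count_cat IH /= addn0 addnC.
by rewrite -[t.+1]addn1 iotaD add1n addn1.
Qed.

Lemma size_word (T : Type) (X : nat -> T -> nat) (t : nat) (w : T) :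
  size (word X t w) = t.
Proof. by elim: t => //= t ->. Qed.

Lemma nth_word (T : Type) (X : nat -> T -> nat) (t k : nat) (w : T) :
  (k < t)%N -> nth 0%N (word X t w) k = X (t - k)%N w.
Proof. by elim: t k => // t IH [|k] //= kt; rewrite IH. Qed.

Lemma words_size (n t : nat) (s : seq nat) : s \in words n t -> size s = t.
Proof.
elim: t s => [|t IH] s; first by rewrite inE => /eqP->.
by case/allpairsP => -[a s'] /= [_ /IH <- ->].
Qed.

Lemma words_letters (n t a : nat) (s : seq nat) :
  s \in words n t -> a \in s -> (1 <= a <= n)%N.
Proof.
elim: t s => [|t IH] s; first by rewrite inE => /eqP->.
case/allpairsP => -[b s'] /= [+ /IH s'_letters ->].
by rewrite mem_iota add1n ltnS inE => bn /predU1P[->|/s'_letters].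
Qed.

Section Draws.
Variables (R : realType) (d : measure_display) (T : measurableType d).
Variables (P : probability T R) (n : nat) (X : nat -> {RV P >-> nat}).
Hypothesis coupons : coupon_collecting n X.

Lemma mem_word t w : word X t w \in words n t.
Proof.
elim: t => [|t IH]; first by rewrite inE.
by apply: mem_words_cons => //; case: coupons => X_range _ _; exact: X_range.
Qed.

Lemma measurable_word_eq t s : measurable [set w | word X t w = s].
Proof.
elim: t s => [|t IH] [|a s].
- by rewrite (_ : [set _ | _] = setT) //; apply/seteqP; split.
- by rewrite (_ : [set _ | _] = set0) //; apply/seteqP; split.
- by rewrite (_ : [set _ | _] = set0) //; apply/seteqP; split.
rewrite (_ : [set _ | _] = X t.+1 @^-1` [set a] `&` [set w | word X t w = s]).
  by apply: measurableI => //; exact: measurable_funPTI.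
by apply/seteqP; split => w /= => [[]|[-> ->]].
Qed.

(** The word takes finitely many values, so every property of it is a finite union of measurable
    events. *)
Lemma measurable_word t (Q : set (seq nat)) : measurable [set w | Q (word X t w)].
Proof.
rewrite (_ : [set _ | _] =
  \big[setU/set0]_(s <- words n t | `[< Q s >]) [set w | word X t w = s]).
  by apply: bigsetU_measurable => s _; exact: measurable_word_eq.
apply/seteqP; split => w /=.
  move=> Qw; rewrite -bigcup_seq_cond; exists (word X t w) => //=.
  by rewrite mem_word; exact/asboolP.
by rewrite -bigcup_seq_cond => -[s /= /andP[_ /asboolP Qs] ->].
Qed.

Lemma prob_word_eq t s : s \in words n t ->
  P [set w | word X t w = s] = (n%:R^-1 ^+ t)%:E.
Proof.
move=> s_word; have s_size := words_size s_word.
case: coupons => _ X_unif X_indep.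
(* Words list the draws backwards: step [j] sits at position [t - j]. Independence over steps 1 to
   [t] then gives a product of [t] factors [1/n]. *)
rewrite (_ : [set _ | _] = \bigcap_(j in [set` iota 1 t])
    X j @^-1` [set nth 0%N s (t - j)]); last first.
  apply/seteqP; split => w /=.
    move=> <- j /=; rewrite mem_iota add1n ltnS => /andP[j0 jt] /=.
    by rewrite nth_word ?subKn // ltn_subrL j0 (leq_trans j0).
  move=> Xs; apply: (@eq_from_nth _ 0%N); rewrite size_word // => k kt.
  rewrite nth_word // (Xs (t - k)%N) ?subKn 1?ltnW //=.
  by rewrite mem_iota subn_gt0 kt add1n ltnS leq_subr.
rewrite (X_indep (iota 1 t) (fun j => [set nth 0%N s (t - j)])) //; last first.
- by move=> j /=; rewrite mem_iota => /andP[].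
- exact: iota_uniq.
rewrite big_seq_cond (eq_bigr (fun=> (n%:R^-1)%:E)); last first.
  move=> j; rewrite andbT mem_iota add1n ltnS => /andP[j0 jt].
  rewrite X_unif //; apply: words_letters s_word _.
  by rewrite mem_nth // s_size ltn_subrL j0 (leq_trans j0).
rewrite -big_seq_cond prodEFin.
by rewrite big_const_seq count_predT size_iota iter_mulr_1.
Qed.

(** Subadditivity over the list of words satisfying [Q], each of probability [n^-t]; repetitions in
    a list would only enlarge the bound. *)
Lemma prob_word_le t (Q : pred (seq nat)) :
  (P [set w | Q (word X t w)] <= ((count Q (words n t))%:R / n%:R ^+ t)%:E)%E.
Proof.
suff h (L : seq (seq nat)) : {subset L <= words n t} ->
    (P [set w | word X t w \in L] <= ((size L)%:R / n%:R ^+ t)%:E)%E.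
  rewrite -size_filter; apply: le_trans (h _ _); last first.
    by move=> s; rewrite mem_filter => /andP[].
  rewrite (_ : [set w | Q _] = [set w | word X t w \in [seq s <- words n t | Q s]]) //.
  by apply/seteqP; split => w /=; rewrite mem_filter mem_word andbT.
elim: L => [|s L IH] sL.
  rewrite (_ : [set _ | _] = set0) ?measure0 ?lee_fin ?mul0r //.
  by apply/seteqP; split.
rewrite (_ : [set _ | _] =
  [set w | word X t w = s] `|` [set w | word X t w \in L]); last first.
  apply/seteqP; split => w /=; rewrite inE.
    by case/predU1P => [->|]; [left|right].
  by case=> [->|->]; rewrite ?eqxx ?orbT.
apply: le_trans (measureU2 _ _ _) _; first exact: measurable_word_eq.
  exact: (measurable_word t (fun s => s \in L)).
rewrite /= -(natr1 (size L)) mulrDl mul1r addrC EFinD leeD //.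
  by apply: IH => u uL; apply: sL; rewrite inE uL orbT.
by rewrite -exprVn -(prob_word_eq (sL s (mem_head _ _))).
Qed.

End Draws.

(** * Concentration *)

Lemma prob_bigsetU_le (R : realType) (d : measure_display)
    (T : measurableType d) (P : probability T R) (K : nat)
    (A : nat -> set T) (e : R) :
  (forall k, measurable (A k)) -> (forall k, (k < K)%N -> (P (A k) <= e%:E)%E) ->
  (P (\big[setU/set0]_(k < K) A k) <= (K%:R * e)%:E)%E.
Proof.
move=> mA PA; apply: le_trans (le_mu_bigsetU P (fun i _ => mA i)) _.
apply: (@le_trans _ _ (\sum_(k < K) e%:E)%E).
  by apply: lee_sum => k _; exact: PA.
by rewrite sumEFin lee_fin sumr_const card_ord mulr_natl.
Qed.

Section Concentration.
Variables (R : realType) (l : nat) (z : nat -> R -> R).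
Hypothesis z_sol : coupon_ode_solution l z.
Variables (d : measure_display) (T : measurableType d) (P : probability T R).
Variables (n : nat) (X : nat -> {RV P >-> nat}).
Hypothesis n_gt0 : (0 < n)%N.
Hypothesis coupons : coupon_collecting n X.

Let dev t i w := deviation z n t i (word X t w).

(** Chebyshev's inequality by counting: each word with deviation above [m] adds at least [m^2] to
    the sum of squares. *)
Lemma prob_deviation_gt t i (m : R) : (i <= l)%N -> 0 < m ->
  (P [set w | (m < `|dev t i w|)%R] <= (25 * i.+1%:R * n%:R / m ^+ 2)%:E)%E.
Proof.
move=> il m0.
have n0 : 0 < n%:R ^+ t :> R by rewrite exprn_gt0 // ltr0n.
have := prob_word_le coupons t (fun s => m < `|deviation z n t i s|).
move=> /le_trans; apply.
rewrite lee_fin ler_pdivrMr // mulrAC ler_pdivlMr ?exprn_gt0 //.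
apply: le_trans (sum_deviation_sqr_le z_sol n_gt0 t il).
rewrite -sum1_count natr_sum mulr_suml big_mkcond /=; apply: ler_sum => s _.
case: ifP => [ms|_]; last exact: sqr_ge0.
by rewrite mul1r -[leRHS]real_normK ?num_real // lerXn2r ?nnegrE // ltW.
Qed.

Lemma deviation_word_lipschitz t k i w : (i <= l)%N ->
  `|dev (t + k) i w - dev t i w| <= 3 * k%:R.
Proof.
move=> il; elim: k => [|k IH]; first by rewrite addn0 subrr normr0 mulr0.
have X_range : X (t + k).+1 w \in iota 1 n.
  by rewrite mem_iota add1n ltnS; case: coupons => X_range _ _; exact: X_range.
have := deviation_increment_le z_sol n_gt0 (t + k) (word X (t + k) w) il X_range.
rewrite addnS -(natr1 k) mulrDr mulr1 => h.
rewrite -(subrKA (dev (t + k) i w)) addrC.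
exact: le_trans (ler_normD _ _) (lerD IH h).
Qed.

(* Chebyshev on the grid of multiples of [m]; between grid points the
   deviation moves by at most [3 m]. *)
Lemma prob_deviation_le (m K : nat) (E : set T) : (0 < m)%N -> measurable E ->
  [set w | forall t i, (t < K * m)%N -> (0 < i < l)%N ->
     `|dev t i w| <= 4 * m%:R] `<=` E ->
  ((1 - K%:R * (l%:R * (25 * l%:R * n%:R / m%:R ^+ 2)))%:E <= P E)%E.
Proof.
move=> m0 mE subE.
have m0R : 0 < m%:R :> R by rewrite ltr0n.
pose B k i := [set w | m%:R < `|dev (k * m) i w|].
have mB k i : measurable (B k i).
  exact: (measurable_word coupons (k * m)
    (fun s => m%:R < `|deviation z n (k * m) i s|)).
pose bad := \big[setU/set0]_(k < K) \big[setU/set0]_(i < l) B k i.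
have mbad k : measurable (\big[setU/set0]_(i < l) B k i).
  by apply: bigsetU_measurable.
have Pbad : (P bad <= (K%:R * (l%:R * (25 * l%:R * n%:R / m%:R ^+ 2)))%:E)%E.
  apply: (prob_bigsetU_le mbad) => k _; apply: (prob_bigsetU_le (mB k)) => i il.
  apply: le_trans (prob_deviation_gt _ (ltnW il) m0R) _.
  rewrite lee_fin ler_wpM2r ?invr_ge0 ?exprn_ge0 // ler_wpM2r //.
  by rewrite ler_wpM2l // ler_nat.
have mbadT : measurable bad by apply: bigsetU_measurable.
have badE : ~` bad `<=` E.
  move=> w /= good; apply: subE => t i tK /andP[_ il] /=.
  have kK : (t %/ m < K)%N by rewrite ltn_divLR.
  have {good} : `|dev (t %/ m * m) i w| <= m%:R.
    rewrite leNgt; apply/negP => Bw; apply: good.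
    rewrite /bad -(bigcup_mkord K (fun k => \big[setU/set0]_(i < l) B k i)).
    exists (t %/ m)%N => //.
    by rewrite -(bigcup_mkord l (B (t %/ m)%N)); exists i.
  (* At most [m] at the preceding grid point, plus at most 3 for each of fewer than [m] further
     draws, gives [4 m]. *)
  have := deviation_word_lipschitz (t %/ m * m) (t %% m) w (ltnW il).
  rewrite -divn_eq => h1 h2.
  have h3 : (t %% m)%:R <= m%:R :> R by rewrite ler_nat ltnW // ltn_mod.
  rewrite -(subrK (dev (t %/ m * m) i w) (dev t i w)).
  apply: le_trans (ler_normD _ _) _; lra.
apply: (@le_trans _ _ (P (~` bad))); last first.
  by apply: le_measure => //; rewrite inE //; exact: measurableC.
by rewrite probability_setC // EFinB leeB.
Qed.

End Concentration.

(** * Choice of the grid and its asymptotics *)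

Section GridScale.
Variable R : realType.

(* With [y = root8 n], the step [y^7] is [o(n)], while the at most [9 y^2] grid points
   fail with total probability of order [y^2 * n / y^14 = y^-4]. *)
Definition root8 (n : nat) : R := Num.sqrt (Num.sqrt (Num.sqrt n%:R)).

Lemma root8X8 n : root8 n ^+ 8 = n%:R.
Proof.
by rewrite (exprM _ 2 4) (exprM _ 2 2) !sqr_sqrtr ?sqrtr_ge0.
Qed.

Lemma root8_ge1 n : (0 < n)%N -> 1 <= root8 n.
Proof.
move=> n0; rewrite -(@ler_pXn2r _ 8) ?nnegrE ?sqrtr_ge0 //.
by rewrite expr1n root8X8 ler1n.
Qed.

Lemma root8V_cvg0 : (root8 n)^-1 @[n --> \oo] --> (0 : R).
Proof.
have sqrt_cvg0 (u : nat -> R) : u n @[n --> \oo] --> (0 : R) ->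
    Num.sqrt (u n) @[n --> \oo] --> (0 : R).
  move=> u0; rewrite -[X in _ --> X]sqrtr0.
  by apply: continuous_cvg => //; exact: sqrt_continuous.
have inv_cvg0 : n%:R^-1 @[n --> \oo] --> (0 : R).
  (* The harmonic sequence is [1/(n+1)], hence the shift by one. *)
  by rewrite -cvg_shiftS; exact: cvg_harmonic.
have := sqrt_cvg0 _ (sqrt_cvg0 _ (sqrt_cvg0 _ inv_cvg0)).
by under eq_fun do rewrite !sqrtrV ?sqrtr_ge0 //.
Qed.

(** With [y = root8 n], the left side is [y^8 * 8 ln y], and [ln y <= y]. *)
Lemma mul_ln_le_root8 n : (0 < n)%N -> n%:R * ln n%:R <= 8 * root8 n ^+ 9.
Proof.
move=> n0; have y0 : 0 < root8 n := lt_le_trans ltr01 (root8_ge1 n0).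
have ln_le : ln (root8 n) <= root8 n := ltW (ln_sublinear y0).
rewrite -{1 2}root8X8 lnXn // mulrnAr -[X in X <= _]mulr_natl (exprSr _ 8) ler_wpM2l //.
by rewrite ler_wpM2l // exprn_ge0 // ltW.
Qed.

(** Truncating and adding one gives positive integers strictly above [y^7] and, for the grid size,
    above [8 y^2]. Their product therefore exceeds [8 y^9], which bounds [n ln n]. *)
Definition grid_step n := (Num.trunc (root8 n ^+ 7)).+1.
Definition grid_size n := (Num.trunc (8 * root8 n ^+ 2)).+1.

Lemma grid_step_ge n : root8 n ^+ 7 <= (grid_step n)%:R.
Proof. exact/ltW/truncnS_gt. Qed.

Lemma grid_step_le n : (0 < n)%N -> (grid_step n)%:R <= 2 * root8 n ^+ 7.
Proof.
move=> n0; rewrite /grid_step -natr1 mulrDl mul1r lerD //.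
  by rewrite truncn_le exprn_ge0 // sqrtr_ge0.
by rewrite exprn_ege1 // root8_ge1.
Qed.

Lemma grid_size_le n : (0 < n)%N -> (grid_size n)%:R <= 9 * root8 n ^+ 2.
Proof.
move=> n0; have -> : 9 * root8 n ^+ 2 = 8 * root8 n ^+ 2 + root8 n ^+ 2 by ring.
rewrite /grid_size -(natr1 (Num.trunc _)) lerD //.
  by rewrite truncn_le mulr_ge0 // exprn_ge0 // sqrtr_ge0.
by rewrite exprn_ege1 // root8_ge1.
Qed.

Lemma lt_grid n t : (0 < n)%N -> t%:R <= n%:R * ln (n%:R : R) ->
  (t < grid_size n * grid_step n)%N.
Proof.
move=> n0 tn; have y0 : 0 < root8 n := lt_le_trans ltr01 (root8_ge1 n0).
rewrite -(ltr_nat R) natrM; apply: le_lt_trans tn _.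
apply: le_lt_trans (mul_ln_le_root8 n0) _.
rewrite (exprD _ 2 7) mulrA; apply: ltr_pM; rewrite ?mulr_ge0 ?exprn_ge0 ?ltW //.
all: exact: truncnS_gt.
Qed.

(** Here [c] stands for [l]. The size is at most [9 y^2] and the step at least [y^7], so the bound
    is [9 * 25 c^2 y^(2 + 8 - 14)]. *)
Lemma grid_failure_le n (c : R) : (0 < n)%N -> 0 <= c ->
  (grid_size n)%:R * (c * (25 * c * n%:R / (grid_step n)%:R ^+ 2))
  <= 225 * c ^+ 2 * (root8 n)^-1 ^+ 4.
Proof.
move=> n0 c0; have y0 : 0 < root8 n := lt_le_trans ltr01 (root8_ge1 n0).
have -> : 225 * c ^+ 2 * (root8 n)^-1 ^+ 4
  = 9 * root8 n ^+ 2 * (c * (25 * c * root8 n ^+ 8 / (root8 n ^+ 7) ^+ 2)).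
  by field; rewrite gt_eqF.
rewrite root8X8; apply: ler_pM; rewrite ?grid_size_le // ?mulr_ge0 ?invr_ge0 ?exprn_ge0 //.
rewrite ler_wpM2l // ler_wpM2l ?mulr_ge0 // lef_pV2 ?posrE ?exprn_gt0 ?ltr0n //.
by rewrite lerXn2r ?nnegrE ?exprn_ge0 ?grid_step_ge // ltW.
Qed.

End GridScale.

(** * Conclusion by squeezing both limits *)

Theorem theorem3 (R : realType) (l : nat) (l_gt0 : (0 < l)%N)
    (d : nat -> measure_display) (T : forall n : nat, measurableType (d n))
    (P : forall n : nat, probability (T n) R)
    (X : forall n : nat, nat -> {RV (P n) >-> nat})
    (coupons : forall n : nat, (0 < n)%N -> coupon_collecting n (X n))
    (z : nat -> R -> R) (z_sol : coupon_ode_solution l z) :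
  exists omega : nat -> R,
    (omega n / n%:R @[n --> \oo] --> 0) /\
    (P n [set w : T n | forall t i : nat,
            t%:R <= n%:R * ln (n%:R : R) -> (0 < i < l)%N ->
            `|(num_types n (X n) t i w)%:R - n%:R * z i (t%:R / n%:R)|
              <= omega n] @[n --> \oo] --> 1%E).
Proof.
(* This is the uniform deviation bound of [prob_deviation_le]. It is at most [8 y^7] while
   [n = y^8], so the ratio is at most [8 / y]. *)
exists (fun n => 4 * (grid_step R n)%:R); split.
  apply: (@squeeze_cvgr _ _ _ _ (fun=> 0) (fun n => 8 * (root8 R n)^-1)).
  - near=> n; have n0 : (0 < n)%N by near: n; exact: nbhs_infty_gt.
    have y0 : 0 < root8 R n := lt_le_trans ltr01 (root8_ge1 R n0).
    rewrite divr_ge0 ?mulr_ge0 //= ler_pdivrMr ?ltr0n // -(root8X8 R n).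
    have -> : 8 / root8 R n * root8 R n ^+ 8 = 4 * (2 * root8 R n ^+ 7).
      by field; rewrite gt_eqF.
    by rewrite ler_wpM2l // grid_step_le.
  - exact: cvg_cst.
  - rewrite -[X in _ --> X](mulr0 8); apply: cvgMr; exact: root8V_cvg0.
apply: (@squeeze_cvge _ _ _ _
  (fun n => (1 - 225 * l%:R ^+ 2 * (root8 R n)^-1 ^+ 4)%:E) _ (fun=> 1%E)).
- near=> n; have n0 : (0 < n)%N by near: n; exact: nbhs_infty_gt.
  set E := [set w | _].
  have mE : measurable E.
    (* The time restriction is kept inside [Q], so that [E] is a countable intersection over all [t]
       of events depending on the word of length [t]. *)
    pose Q t s := forall i, t%:R <= n%:R * ln (n%:R : R) -> (0 < i < l)%N ->
      `|(occ n i s)%:R - n%:R * z i (t%:R / n%:R)| <= 4 * (grid_step R n)%:R.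
    rewrite (_ : E = \bigcap_t [set w | Q t (word (X n) t w)]).
      by apply: bigcapT_measurable => t; exact: measurable_word (coupons n n0) _ _.
    apply/seteqP; split => [w Ew t _ i ti il|w Ew t i ti il].
      by rewrite -num_types_word; exact: Ew.
    by rewrite num_types_word; exact: (Ew t).
  rewrite probability_le1 // andbT.
  apply: le_trans (prob_deviation_le (K := grid_size R n) z_sol n0 (coupons n n0)
    (ltn0Sn _ : (0 < grid_step R n)%N) mE _).
    by rewrite lee_fin lerB // grid_failure_le.
  move=> w hw t i tn il; rewrite num_types_word.
  exact: hw (lt_grid n0 tn) il.
- apply: cvg_EFin; first by apply: nearW.
  rewrite -[X in _ --> X]subr0 -[X in _ - X](mulr0 (225 * l%:R ^+ 2)).
  apply: cvgB; first exact: cvg_cst.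
  apply: cvgMr; rewrite (_ : 0 = 0 ^+ 4); last by rewrite expr0n.
  exact: cvg_comp (@root8V_cvg0 R) (@exprn_continuous R 4 0).
- exact: cvg_cst.
Unshelve. all: by end_near.
Qed.
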